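(* Let $\mathcal H$ be a Hopf algebra, $\Phi\in\mathcal H\otimes\mathcal H$ a twist, $\mathcal A$ an $\mathcal H$-module algebra, and $\mathcal W$ an $\mathcal H$-covariant module over $\mathcal A$. Let $\tilde{\mathcal A}$ be the twisted module algebra over the twisted Hopf algebra $\tilde{\mathcal H}$, and let $\widetilde{\mathcal W}$ be $\mathcal W$ with the same action of $\tilde{\mathcal H}=\mathcal H$ and with $$a*w=\Phi_1a\cdot\Phi_2w,\qquad a\in\mathcal A,\ w\in\mathcal W .$$ Then $*$ defines an action of the algebra $\tilde{\mathcal A}$ on $\widetilde{\mathcal W}$, and $\widetilde{\mathcal W}$ is an $\tilde{\mathcal H}$-covariant module over $\tilde{\mathcal A}$.
   Context: $\mathcal H$ has coproduct $\Delta(h)=h^{(1)}\otimes h^{(2)}$ (Sweedler notation, summation suppressed), counit $\varepsilon$ and antipode $S$. A twist is an invertible element $\Phi=\Phi_1\otimes\Phi_2\in\mathcal H\otimes\mathcal H$ (summation suppressed) such that $$(\Delta\otimes \mathrm{id})(\Phi)\,\Phi_{12}=(\mathrm{id}\otimes\Delta)(\Phi)\,\Phi_{23},\qquad (\varepsilon\otimes \mathrm{id})(\Phi)=1=(\mathrm{id}\otimes\varepsilon)(\Phi).$$ The twisted Hopf algebra $\tilde{\mathcal H}$ equals $\mathcal H$ as an algebra, has the same counit, and has coproduct $\tilde\Delta(h)=\Phi^{-1}\Delta(h)\Phi$. An $\mathcal H$-module algebra is an associative algebra $\mathcal A$ with an $\mathcal H$-action satisfying $h(a\cdot b)=h^{(1)}a\cdot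 h^{(2)}b$. The twisted module algebra $\tilde{\mathcal A}$ is the $\mathcal H$-module $\mathcal A$ with the associative product $a*b=\Phi_1a\cdot\Phi_2b$; it is an $\tilde{\mathcal H}$-module algebra. An $\mathcal H$-covariant module over $\mathcal A$ is a vector space $\mathcal W$ carrying actions $\pi$ of $\mathcal A$ and $\rho$ of $\mathcal H$ with $\pi(ha)=\rho(h^{(1)})\pi(a)\rho(S(h^{(2)}))$; equivalently, $h(a\cdot w)=h^{(1)}a\cdot h^{(2)}w$ for all $h\in\mathcal H$, $a\in\mathcal A$, $w\in\mathcal W$. The same definition applies with $\tilde{\mathcal H},\tilde\Delta,\tilde{\mathcal A},*$ in place of $\mathcal H,\Delta,\mathcal A,\cdot$. *)

(* Defs.v *)
From HB Require Import structures.
From mathcomp Require Import all_boot all_algebra.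
From mathcomp Require Import boolp classical_sets.

Set Implicit Arguments.
Unset Strict Implicit.
Unset Printing Implicit Defensive.

Import GRing.Theory.
Local Open Scope ring_scope.
Local Open Scope quotient_scope.

(* Predicate form of [{bilinear U -> V -> W}], for maps that are given as data. *)
Notation is_bilinear f := (bilinear_for *:%R *:%R f).

Section Tensor.

Variables (k : fieldType) (V W : lmodType k).

(* Formal sums of pairs, modulo the bilinearity relations.  Opposites need no
   separate generator, because -(v (x) w) is represented by (- v, w). *)
Inductive tens_eq : seq (V * W) -> seq (V * W) -> Prop :=
| Tens_refl s : tens_eq s s
| Tens_sym s t : tens_eq s t -> tens_eq t s
| Tens_trans s t u : tens_eq s t -> tens_eq t u -> tens_eq s u
| Tens_cat s s' t t' :
    tens_eq s s' -> tens_eq t t' -> tens_eq (s ++ t) (s' ++ t')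
| Tens_catC s t : tens_eq (s ++ t) (t ++ s)
| Tens_0 w : tens_eq [:: (0, w)] [::]
| Tens_Dl v v' w : tens_eq [:: (v + v', w)] [:: (v, w); (v', w)]
| Tens_Dr v w w' : tens_eq [:: (v, w + w')] [:: (v, w); (v, w')]
| Tens_Z a v w : tens_eq [:: (a *: v, w)] [:: (v, a *: w)].

Definition tens_eqb s t := `[< tens_eq s t >].

Fact tens_eqb_refl : reflexive tens_eqb.
Proof. by move=> s; apply/asboolP/Tens_refl. Qed.

Fact tens_eqb_sym : symmetric tens_eqb.
Proof. by move=> s t; apply/asboolP/asboolP => /Tens_sym. Qed.

Fact tens_eqb_trans : transitive tens_eqb.
Proof.
by move=> t s u /asboolP st /asboolP tu; apply/asboolP/(Tens_trans st tu).
Qed.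

Canonical tens_equiv :=
  EquivRel tens_eqb tens_eqb_refl tens_eqb_sym tens_eqb_trans.

Definition tensor := {eq_quot tens_equiv}.

HB.instance Definition _ := Choice.on tensor.
HB.instance Definition _ := EqQuotient.on tensor.

Lemma tens_piP s t : (\pi_tensor s = \pi_tensor t) <-> tens_eq s t.
Proof.
by split=> [/eqP|st]; first rewrite eqmodE => /asboolP //;
  apply/eqP; rewrite eqmodE; apply/asboolP.
Qed.

Lemma tens_repr s : tens_eq (repr (\pi_tensor s)) s.
Proof. by apply/tens_piP; rewrite reprK. Qed.

Lemma tensW (P : tensor -> Prop) :
  (forall s, P (\pi_tensor s)) -> forall x, P x.
Proof. by move=> Ps x; rewrite -[x]reprK. Qed.

Definition seqZ (a : k) (s : seq (V * W)) := [seq (a *: p.1, p.2) | p <- s].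

Lemma tens_seqZ a s t : tens_eq s t -> tens_eq (seqZ a s) (seqZ a t).
Proof.
elim=> {s t}.
- by move=> s; apply: Tens_refl.
- by move=> s t _; apply: Tens_sym.
- by move=> s t u _ st _; apply: Tens_trans.
- by move=> s s' t t' _ ss' _ tt'; rewrite /seqZ !map_cat; apply: Tens_cat.
- by move=> s t; rewrite /seqZ !map_cat; apply: Tens_catC.
- by move=> w /=; rewrite scaler0; apply: Tens_0.
- by move=> v v' w /=; rewrite scalerDr; apply: Tens_Dl.
- by move=> v w w' /=; apply: Tens_Dr.
- by move=> b v w /=; rewrite scalerA mulrC -scalerA; apply: Tens_Z.
Qed.

Definition tens_add (x y : tensor) := \pi_tensor (repr x ++ repr y).
Definition tens_scale a (x : tensor) := \pi_tensor (seqZ a (repr x)).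
Definition tens_zero := \pi_tensor [::].

Lemma tens_addE s t : tens_add (\pi_tensor s) (\pi_tensor t) = \pi_tensor (s ++ t).
Proof. by rewrite /tens_add; apply/tens_piP; apply: Tens_cat; apply: tens_repr. Qed.

Lemma tens_scaleE a s : tens_scale a (\pi_tensor s) = \pi_tensor (seqZ a s).
Proof. by rewrite /tens_scale; apply/tens_piP; apply/tens_seqZ/tens_repr. Qed.

Fact tens_addA : associative tens_add.
Proof. by elim/tensW=> s; elim/tensW=> t; elim/tensW=> u; rewrite !tens_addE catA. Qed.

Fact tens_addC : commutative tens_add.
Proof.
by elim/tensW=> s; elim/tensW=> t; rewrite !tens_addE; apply/tens_piP/Tens_catC.
Qed.

Fact tens_add0 : left_id tens_zero tens_add.
Proof. by elim/tensW=> ?; rewrite tens_addE. Qed.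

Fact tens_scaleDl x : {morph tens_scale^~ x : a b / a + b >-> tens_add a b}.
Proof.
move=> a b; elim/tensW: x => s; rewrite !tens_scaleE !tens_addE.
apply/tens_piP; elim: s => [|[v w] s IHs] /=; first exact: Tens_refl.
rewrite scalerDl -cat1s.
apply: Tens_trans (Tens_cat (Tens_Dl _ _ _) IHs) _ => /=.
apply: (Tens_cat (Tens_refl [:: (a *: v, w)])).
rewrite -cat1s catA -[X in tens_eq _ X]cat_rcons -cats1.
exact: Tens_cat (Tens_catC _ _) (Tens_refl _).
Qed.

Fact tens_addN : left_inverse tens_zero (tens_scale (- 1)) tens_add.
Proof.
have Z1 (x : tensor) : tens_scale 1 x = x.
  elim/tensW: x => s; rewrite tens_scaleE; congr (\pi_tensor _).
  by rewrite /seqZ -[RHS]map_id; apply: eq_map => -[v w]; rewrite scale1r.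
move=> x; rewrite -{2}[x]Z1 -tens_scaleDl addNr; elim/tensW: x => s.
rewrite tens_scaleE; apply/tens_piP; elim: s => [|[v w] s IHs] /=.
  exact: Tens_refl.
by rewrite scale0r -cat1s; apply: Tens_cat (Tens_0 _) IHs.
Qed.

HB.instance Definition _ :=
  GRing.isZmodule.Build tensor tens_addA tens_addC tens_add0 tens_addN.

Fact tens_scaleA a b x : tens_scale a (tens_scale b x) = tens_scale (a * b) x.
Proof.
elim/tensW: x => s; rewrite !tens_scaleE; congr (\pi_tensor _).
by rewrite /seqZ -map_comp; apply: eq_map => -[v w] /=; rewrite scalerA.
Qed.

Fact tens_scale1 : left_id 1 tens_scale.
Proof.
elim/tensW=> s; rewrite tens_scaleE; congr (\pi_tensor _).
by rewrite /seqZ -[RHS]map_id; apply: eq_map => -[v w]; rewrite scale1r.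
Qed.

Fact tens_scaleDr : right_distributive tens_scale +%R.
Proof.
move=> a; elim/tensW=> s; elim/tensW=> t.
by rewrite /GRing.add /= tens_addE !tens_scaleE tens_addE /seqZ map_cat.
Qed.

HB.instance Definition _ := GRing.Zmodule_isLmodule.Build k tensor
  tens_scaleA tens_scale1 tens_scaleDr tens_scaleDl.

Lemma tens_piD s t : \pi_tensor s + \pi_tensor t = \pi_tensor (s ++ t).
Proof. exact: tens_addE. Qed.

Lemma tens_piZ a s : a *: (\pi_tensor s : tensor) = \pi_tensor (seqZ a s).
Proof. exact: tens_scaleE. Qed.

Definition tens (v : V) (w : W) : tensor := \pi_tensor [:: (v, w)].

(* The linear map induced by [f] when [f] is bilinear (see [tliftE] and
   [tlift_linear]); on t = sum_i v_i (x) w_i it is sum_i f v_i w_i. *)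
Definition tlift (U : lmodType k) (f : V -> W -> U) (t : tensor) : U :=
  \sum_(p <- repr t) f p.1 p.2.

Lemma tens_bilinear : is_bilinear tens.
Proof.
split=> [w a v v'|v a w w']; rewrite /tens /= tens_piZ tens_piD.
  exact/tens_piP/Tens_Dl.
apply/tens_piP; apply: Tens_trans (Tens_Dr _ _ _) _.
by rewrite -cat1s; apply: Tens_cat (Tens_sym (Tens_Z _ _ _)) (Tens_refl _).
Qed.

Section Lift.

Variables (U : lmodType k) (f : V -> W -> U).
Hypothesis f_lin : is_bilinear f.

Let fl w : {linear V -> U} := HB.pack (f ^~ w)
  (GRing.isLinear.Build k V U *:%R (f ^~ w) (f_lin.1 w)).
Let fr v : {linear W -> U} := HB.pack (f v)
  (GRing.isLinear.Build k W U *:%R (f v) (f_lin.2 v)).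

Lemma tlift_pi s : tlift f (\pi_tensor s) = \sum_(p <- s) f p.1 p.2.
Proof.
suff E t u : tens_eq t u ->
    \sum_(p <- t) f p.1 p.2 = \sum_(p <- u) f p.1 p.2 by apply/E/tens_repr.
elim=> // {s t u}.
- by move=> s t u _ -> _ ->.
- by move=> s s' t t' _ IHs _ IHt; rewrite !big_cat /= IHs IHt.
- by move=> s t; rewrite !big_cat /= addrC.
- by move=> w; rewrite big_seq1 big_nil; apply: (raddf0 (fl w)).
- by move=> v v' w; rewrite big_seq1 big_cons big_seq1; apply: (raddfD (fl w)).
- by move=> v w w'; rewrite big_seq1 big_cons big_seq1; apply: (raddfD (fr v)).
- move=> a v w; rewrite !big_seq1 /=.
  by rewrite [LHS](linearZ_LR (fl w)) [RHS](linearZ_LR (fr v)).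
Qed.

Lemma tliftE v w : tlift f (tens v w) = f v w.
Proof. by rewrite tlift_pi big_seq1. Qed.

Lemma tlift_linear : linear (tlift f).
Proof.
move=> a; elim/tensW=> s; elim/tensW=> t.
rewrite tens_piZ tens_piD !tlift_pi big_cat big_map scaler_sumr; congr (_ + _).
by apply: eq_bigr => -[v w] _; apply: (linearZ_LR (fl w)).
Qed.

End Lift.

Lemma tens_ind (P : tensor -> Prop) :
  P 0 -> (forall v w t, P t -> P (tens v w + t)) -> forall t, P t.
Proof.
move=> P0 PD; elim/tensW; elim=> [|[v w] s IHs]; first exact: P0.
have -> : \pi_tensor ((v, w) :: s) = tens v w + \pi_tensor s.
  by rewrite tens_piD.
exact: PD.
Qed.

Lemma tens_sum (t : tensor) : exists s, t = \sum_(p <- s) tens p.1 p.2.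
Proof.
elim/tens_ind: t => [|v w t [s ->]]; first by exists [::]; rewrite big_nil.
by exists ((v, w) :: s); rewrite big_cons.
Qed.

Lemma tens_ext (U : lmodType k) (f g : tensor -> U) :
  linear f -> linear g -> (forall v w, f (tens v w) = g (tens v w)) -> f =1 g.
Proof.
move=> fL gL fg.
pose F : {linear tensor -> U} := HB.pack f
  (GRing.isLinear.Build k tensor U *:%R f fL).
pose G : {linear tensor -> U} := HB.pack g
  (GRing.isLinear.Build k tensor U *:%R g gL).
elim/tens_ind=> [|v w t IHt]; first by rewrite [LHS](raddf0 F) [RHS](raddf0 G).
by rewrite [LHS](raddfD F) [RHS](raddfD G) /= fg IHt.
Qed.

End Tensor.

Arguments tensor {k} (V W)%_type_scope.
Arguments tens {k V W} v w.

Notation "V ⊗ W" := (tensor V W) (at level 40, left associativity) : type_scope.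
Notation "v ⊗ w" := (tens v w) (at level 40, left associativity) : ring_scope.

Section TensorTheory.

Variables (k : fieldType) (V W : lmodType k).

Lemma tensDl (v v' : V) (w : W) : (v + v') ⊗ w = v ⊗ w + v' ⊗ w.
Proof. by have := (tens_bilinear V W).1 w 1 v v'; rewrite /= !scale1r. Qed.

Lemma tensDr (v : V) (w w' : W) : v ⊗ (w + w') = v ⊗ w + v ⊗ w'.
Proof. by have := (tens_bilinear V W).2 v 1 w w'; rewrite /= !scale1r. Qed.

Lemma tensZl c (v : V) (w : W) : (c *: v) ⊗ w = c *: (v ⊗ w).
Proof.
have tens0 : (0 : V) ⊗ w = 0.
  by apply: (addrI (0 ⊗ w)); rewrite -tensDl !addr0.
by have := (tens_bilinear V W).1 w c v 0; rewrite /= tens0 !addr0.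
Qed.

Lemma tensZr c (v : V) (w : W) : v ⊗ (c *: w) = c *: (v ⊗ w).
Proof.
have tens0 : v ⊗ (0 : W) = 0.
  by apply: (addrI (v ⊗ 0)); rewrite -tensDr !addr0.
by have := (tens_bilinear V W).2 v c w 0; rewrite /= tens0 !addr0.
Qed.

End TensorTheory.

Lemma exists_functional (k : fieldType) (V : lmodType k) (v : V) :
  v != 0 -> exists2 f : V -> k^o, linear f & f v = 1.
Proof.
move=> v0.
pose P (M : set V) := (forall a x y, M x -> M y -> M (a *: x + y)) /\ ~ M v.
have [|M [[Mlin Mv] Mmax]] := @Zorn_bigcup V P.
  move=> F FP Ftot; split=> [a x y [X FX Xx] [Y FY Yy]|[X FX]]; last first.
    by have [] := FP X FX.
  have [XY|YX] := Ftot X Y FX FY.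
    by exists Y => //; apply: (FP Y FY).1 => //; apply: XY.
  by exists X => //; apply: (FP X FX).1 => //; apply: YX.
have M0 : M 0.
  apply: contrapT => nM0; apply: (Mmax [set 0 : V]%classic); last first.
    split=> [a x y -> ->|/esym/eqP]; first by rewrite scaler0 addr0.
    by rewrite eq_sym (negbTE v0).
  have Me x : ~ M x.
    by move=> Mx; apply: nM0; have := Mlin (- 1) x x Mx Mx; rewrite scaleN1r addNr.
  by split=> [x /Me //|/(_ 0 erefl)].
have Mex x : exists c : k, M (x - c *: v).
  have [Mx|nMx] := pselect (M x); first by exists 0; rewrite scale0r subr0.
  pose B : set V := fun y => exists2 m, M m & exists c, y = m + c *: x.
  have : ~ P B.
    apply: Mmax; split=> [m Mm|]; first by exists m => //; exists 0; rewrite scale0r addr0.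
    by move=> /(_ x) BM; apply/nMx/BM; exists 0 => //; exists 1; rewrite add0r scale1r.
  move=> nPB; have [[m Mm [c vE]]|nBv] := pselect (B v); last first.
    case: nPB; split=> // a _ _ [m Mm [c ->]] [n Mn [d ->]].
    exists (a *: m + n); first exact: Mlin.
    by exists (a * c + d); rewrite scalerDr scalerDl scalerA addrACA.
  have c0 : c != 0.
    by apply: contra_notN Mv => /eqP c0; rewrite vE c0 scale0r addr0.
  exists c^-1; have := Mlin (- c^-1) m 0 Mm M0.
  have -> : m = v - c *: x by rewrite vE addrK.
  by rewrite addr0 scaleNr scalerBr scalerA mulVf // scale1r opprB.
have Muniq x c d : M (x - c *: v) -> M (x - d *: v) -> c = d.
  move=> Mc Md; apply/eqP; rewrite -subr_eq0; apply: contra_notT Mv => cd.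
  have Mcd : M ((c - d) *: v).
    have := Mlin (- 1) _ _ Mc Md.
    by rewrite scaleN1r opprB addrA subrK scalerBl.
  by have := Mlin (c - d)^-1 _ 0 Mcd M0; rewrite scalerA mulVf // scale1r addr0.
have [f fP] := choice Mex.
exists (f : V -> k^o) => [a x y|]; apply: Muniq (fP _) _; last first.
  by rewrite scale1r subrr.
have := Mlin a _ _ (fP x) (fP y).
by rewrite scalerBr scalerA addrACA -opprD -scalerDl.
Qed.

Section TensorAlgebra.

Variables (k : fieldType) (A B : algType k).

Implicit Types (x y z : A ⊗ B).

Definition tens_one : A ⊗ B := 1 ⊗ 1.

Definition tens_mul x y : A ⊗ B :=
  tlift (fun a b => tlift (fun c d => (a * c) ⊗ (b * d)) y) x.

Let mul_lin a b : is_bilinear (fun (c : A) (d : B) => (a * c) ⊗ (b * d)).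
Proof.
split=> [d r c c'|c r d d'] /=; rewrite mulrDr -scalerAr.
  by rewrite tensDl tensZl.
by rewrite tensDr tensZr.
Qed.

Let mul_lin2 y :
  is_bilinear (fun a b => tlift (fun c d => (a * c) ⊗ (b * d)) y).
Proof.
split=> [b r a a'|a r b b'] /=;
  rewrite /tlift scaler_sumr -big_split /=; apply: eq_bigr => p _.
  by rewrite mulrDl -scalerAl tensDl tensZl.
by rewrite mulrDl -scalerAl tensDr tensZr.
Qed.

Lemma tens_mulE a b c d : tens_mul (a ⊗ b) (c ⊗ d) = (a * c) ⊗ (b * d).
Proof. by rewrite /tens_mul !tliftE. Qed.

Let tens_mul_linl y : linear (tens_mul^~ y).
Proof. exact: (tlift_linear (mul_lin2 y)). Qed.

Let tens_mul_linr x : linear (tens_mul x).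
Proof.
move=> r y z; rewrite /tens_mul /tlift scaler_sumr -big_split /=.
by apply: eq_bigr => p _; apply: (tlift_linear (mul_lin _ _)).
Qed.

Fact tens_mulDl : left_distributive tens_mul +%R.
Proof. by move=> x y z; have := tens_mul_linl z 1 x y; rewrite !scale1r. Qed.

Fact tens_mulDr : right_distributive tens_mul +%R.
Proof. by move=> x y z; have := tens_mul_linr x 1 y z; rewrite !scale1r. Qed.

Let tens_mul0 y : tens_mul 0 y = 0.
Proof. by apply: (addrI (tens_mul 0 y)); rewrite -tens_mulDl !addr0. Qed.

Let tens_mulr0 x : tens_mul x 0 = 0.
Proof. by apply: (addrI (tens_mul x 0)); rewrite -tens_mulDr !addr0. Qed.

Fact tens_mulA : associative tens_mul.
Proof.
elim/tens_ind=> [|a b x IHx] y z; first by rewrite !tens_mul0.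
rewrite !tens_mulDl IHx; congr (_ + _).
elim/tens_ind: y z => [|c d y IHy] z.
  by rewrite tens_mul0 tens_mulr0 tens_mul0.
rewrite tens_mulDl !tens_mulDr tens_mulDl IHy; congr (_ + _).
elim/tens_ind: z => [|e f z IHz]; first by rewrite !tens_mulr0.
by rewrite !tens_mulDr IHz !tens_mulE !mulrA.
Qed.

Fact tens_mul1 : left_id tens_one tens_mul.
Proof.
elim/tens_ind=> [|a b x IHx]; first exact: tens_mulr0.
by rewrite tens_mulDr IHx tens_mulE !mul1r.
Qed.

Fact tens_mulr1 : right_id tens_one tens_mul.
Proof.
elim/tens_ind=> [|a b x IHx]; first exact: tens_mul0.
by rewrite tens_mulDl IHx tens_mulE !mulr1.
Qed.

Fact tens_one_neq0 : tens_one != 0.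
Proof.
have [f f_lin f1] := exists_functional (oner_neq0 A).
have [g g_lin g1] := exists_functional (oner_neq0 B).
pose h a b : k^o := f a * g b.
have h_lin : is_bilinear h.
  split=> [b r a a'|a r b b'] /=; rewrite /h.
    by rewrite f_lin mulrDl -scalerAl.
  by rewrite g_lin mulrDr -scalerAr.
apply/eqP => one0; have := tliftE h_lin 1 1; rewrite -/tens_one one0 /h f1 g1 mulr1.
have := tlift_linear h_lin (- 1) 0 0.
rewrite scaler0 addr0 scaleN1r addNr => -> /esym/eqP.
by apply/negP; exact: (oner_neq0 k).
Qed.

HB.instance Definition _ := GRing.Zmodule_isNzRing.Build (tensor A B)
  tens_mulA tens_mul1 tens_mulr1 tens_mulDl tens_mulDr tens_one_neq0.

Fact tens_scaleAl r x y : r *: (x * y) = r *: x * y.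
Proof.
by have := tens_mul_linl y r x 0; rewrite /= tens_mul0 !addr0.
Qed.

HB.instance Definition _ :=
  GRing.Lmodule_isLalgebra.Build k (tensor A B) tens_scaleAl.

Fact tens_scaleAr r x y : r *: (x * y) = x * (r *: y).
Proof.
by have := tens_mul_linr x r y 0; rewrite /= tens_mulr0 !addr0.
Qed.

HB.instance Definition _ :=
  GRing.Lalgebra_isAlgebra.Build k (tensor A B) tens_scaleAr.

Lemma tensM (a a' : A) (b b' : B) :
  (a ⊗ b) * (a' ⊗ b') = (a * a') ⊗ (b * b').
Proof. exact: tens_mulE. Qed.

Lemma tens1 : 1 ⊗ 1 = 1 :> A ⊗ B.
Proof. by []. Qed.

End TensorAlgebra.

Definition tens_map (k : fieldType) (V V' W W' : lmodType k)
    (f : V -> V') (g : W -> W') : V ⊗ W -> V' ⊗ W' :=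
  tlift (fun v w => f v ⊗ g w).

Definition tens_assoc (k : fieldType) (U V W : lmodType k) :
    (U ⊗ V) ⊗ W -> U ⊗ (V ⊗ W) :=
  tlift (fun x w => tlift (fun u v => u ⊗ (v ⊗ w)) x).

Lemma tens_mapE (k : fieldType) (V V' W W' : lmodType k)
    (f : V -> V') (g : W -> W') v w :
  linear f -> linear g -> tens_map f g (v ⊗ w) = f v ⊗ g w.
Proof.
move=> f_lin g_lin; apply: tliftE; split=> [w0 c v1 v2|v0 c w1 w2] /=.
  by rewrite f_lin tensDl tensZl.
by rewrite g_lin tensDr tensZr.
Qed.

Lemma tens_assocE (k : fieldType) (U V W : lmodType k)
    (u : U) (v : V) (w : W) : tens_assoc ((u ⊗ v) ⊗ w) = u ⊗ (v ⊗ w).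
Proof.
have lin w0 : is_bilinear (fun (u0 : U) (v0 : V) => u0 ⊗ (v0 ⊗ w0)).
  split=> [v0 c u1 u2|u0 c v1 v2] /=; first by rewrite tensDl tensZl.
  by rewrite tensDl tensZl tensDr tensZr.
rewrite /tens_assoc tliftE ?tliftE //.
split=> [w0|x c w1 w2] /=; first exact: tlift_linear.
rewrite /tlift scaler_sumr -big_split; apply: eq_bigr => p _ /=.
by rewrite tensDr tensZr tensDr tensZr.
Qed.

(* Sweedler sums: for [t = comul D h], [tlift f t] is f h^(1) h^(2); for a twist
   [t = Phi], it is f Phi_1 Phi_2.  The maps [f] below are all bilinear as soon
   as the structure maps are linear. *)

Section Hopf.

Variables (k : fieldType) (H : algType k).

Record hopf_data := HopfData {
  comul : H -> H ⊗ H;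
  counit : H -> k;
  antipode : H -> H
}.

Record is_hopf (D : hopf_data) : Prop := IsHopf {
  comul_linear : linear (comul D);
  comul1 : comul D 1 = 1;
  comulM : {morph comul D : g h / g * h};
  comulA : forall h,
    tens_assoc (tens_map (comul D) id (comul D h))
    = tens_map id (comul D) (comul D h);
  counit_linear : scalar (counit D);
  counit1 : counit D 1 = 1;
  counitM : {morph counit D : g h / g * h};
  counitl : forall h, tlift (fun x y => counit D x *: y) (comul D h) = h;
  counitr : forall h, tlift (fun x y => counit D y *: x) (comul D h) = h;
  antipode_linear : linear (antipode D);
  antipodel : forall h,
    tlift (fun x y => antipode D x * y) (comul D h) = (counit D h)%:A;
  antipoder : forall h,
    tlift (fun x y => x * antipode D y) (comul D h) = (counit D h)%:A
}.

(* [PhiV] is the (unique) inverse of [Phi]. *)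
Record is_twist (D : hopf_data) (Phi PhiV : H ⊗ H) : Prop := IsTwist {
  twist_mulV : Phi * PhiV = 1;
  twist_mulVr : PhiV * Phi = 1;
  twist_cocycle :
    tens_assoc (tens_map (comul D) id Phi * (Phi ⊗ 1))
    = tens_map id (comul D) Phi * (1 ⊗ Phi);
  twist_counitl : tlift (fun x y => counit D x *: y) Phi = 1;
  twist_counitr : tlift (fun x y => counit D y *: x) Phi = 1
}.

(* The antipode of the twisted Hopf algebra is h |-> u S(h) u^-1, where
   u = (Phi^-1)_1 S((Phi^-1)_2) and u^-1 = S(Phi_1) Phi_2. *)
Definition twist_hopf (D : hopf_data) (Phi PhiV : H ⊗ H) : hopf_data :=
  let S := antipode D in
  HopfData
    (fun h => PhiV * comul D h * Phi)
    (counit D)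
    (fun h => tlift (fun x y => x * S y) PhiV * S h
              * tlift (fun x y => S x * y) Phi).

Record is_hmodule (V : lmodType k) (rho : H -> V -> V) : Prop := IsHModule {
  hmodule_bilinear : is_bilinear rho;
  hmodule1 : forall v, rho 1 v = v;
  hmoduleM : forall g h v, rho (g * h) v = rho g (rho h v)
}.

(* The product of the module algebra is a map [mu], and no unit is assumed. *)
Record is_module_algebra (D : hopf_data) (A : lmodType k)
    (mu : A -> A -> A) (alpha : H -> A -> A) : Prop := IsModuleAlgebra {
  modalg_hmodule : is_hmodule alpha;
  modalg_bilinear : is_bilinear mu;
  modalgA : associative mu;
  modalg_comul : forall h a b,
    alpha h (mu a b)
    = tlift (fun x y => mu (alpha x a) (alpha y b)) (comul D h)
}.

Record is_algebra_action (A W : lmodType k)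
    (mu : A -> A -> A) (pi : A -> W -> W) : Prop := IsAlgebraAction {
  algact_bilinear : is_bilinear pi;
  algactM : forall a b w, pi (mu a b) w = pi a (pi b w)
}.

Record is_covariant_module (D : hopf_data) (A W : lmodType k)
    (mu : A -> A -> A) (alpha : H -> A -> A)
    (pi : A -> W -> W) (rho : H -> W -> W) : Prop := IsCovariantModule {
  covmod_action : is_algebra_action mu pi;
  covmod_hmodule : is_hmodule rho;
  covmod_covariant : forall h a w,
    pi (alpha h a) w
    = tlift (fun x y => rho x (pi a (rho (antipode D y) w))) (comul D h)
}.

Definition twist_mul (A : lmodType k) (Phi : H ⊗ H)
    (mu : A -> A -> A) (alpha : H -> A -> A) (a b : A) : A :=
  tlift (fun x y => mu (alpha x a) (alpha y b)) Phi.

Definition twist_act (A W : lmodType k) (Phi : H ⊗ H)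
    (alpha : H -> A -> A) (pi : A -> W -> W) (rho : H -> W -> W)
    (a : A) (w : W) : W :=
  tlift (fun x y => pi (alpha x a) (rho y w)) Phi.

End Hopf.

(* Main.v *)
(* The cocycle and coassociativity identities are used in "Sweedler" form: any
   trilinear f may be applied to their three tensor legs.  For * this turns the
   cocycle identity into associativity: with f(x, y, z) = (x a) . ((y b) . (z w)) its
   two sides are (a * b) * w and a * (b * w).  Covariance is equivalent, over any
   Hopf algebra, to h (a . w) = h^(1) a . h^(2) w, and this form passes to the twist
   because Phi (Phi^-1 Delta(h) Phi) = Delta(h) Phi.  Returning to the antipode form
   requires the twisted antipode axioms, which reduce to u v = 1 for
   u = (Phi^-1)_1 S((Phi^-1)_2) and v = S(Phi_1) Phi_2. *)
Require Import Defs.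
From mathcomp Require Import all_boot all_algebra.

Set Implicit Arguments.
Unset Strict Implicit.
Unset Printing Implicit Defensive.

Import GRing.Theory.
Local Open Scope ring_scope.

(** * Linear and bilinear maps given as functions with a linearity proof *)

Section LinearMaps.

Variable k : fieldType.

Lemma linear_sum_seq (V U : lmodType k) (g : V -> U) (I : Type) (r : seq I)
    (F : I -> V) :
  linear g -> g (\sum_(i <- r) F i) = \sum_(i <- r) g (F i).
Proof.
move=> g_lin.
have gD u v : g (u + v) = g u + g v by rewrite -{1}[u]scale1r g_lin scale1r.
have g0 : g 0 = 0 by apply: (addrI (g 0)); rewrite -gD !addr0.
exact: (big_morph g gD g0).
Qed.

Lemma linear_scale (V U : lmodType k) (g : V -> U) c v :
  linear g -> g (c *: v) = c *: g v.
Proof.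
(* The empty sum gives [g 0 = 0]. *)
move=> g_lin; have := linear_sum_seq [::] id g_lin; rewrite !big_nil => g0.
by have := g_lin c v 0; rewrite g0 !addr0.
Qed.

Section Bilinear.

Variables (V W U : lmodType k) (f : V -> W -> U).
Hypothesis f_lin : is_bilinear f.

Lemma bilinear_combl c v v' w : f (c *: v + v') w = c *: f v w + f v' w.
Proof. exact: (f_lin.1 w). Qed.

Lemma bilinear_combr c v w w' : f v (c *: w + w') = c *: f v w + f v w'.
Proof. exact: (f_lin.2 v). Qed.

Lemma bilinear_scalel c v w : f (c *: v) w = c *: f v w.
Proof. exact: (linear_scale _ _ (f_lin.1 w)). Qed.

Lemma bilinear_scaler c v w : f v (c *: w) = c *: f v w.
Proof. exact: (linear_scale _ _ (f_lin.2 v)). Qed.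

End Bilinear.

Lemma mulr_bilinear (A : algType k) : is_bilinear (fun x y : A => x * y).
Proof.
split=> [y c x x'|x c y y'] /=; first by rewrite mulrDl scalerAl.
by rewrite mulrDr scalerAr.
Qed.

Lemma mulr_combl (A : algType k) c (x x' y : A) :
  (c *: x + x') * y = c *: (x * y) + x' * y.
Proof. exact: (bilinear_combl (mulr_bilinear A)). Qed.

Lemma mulr_combr (A : algType k) c (x y y' : A) :
  x * (c *: y + y') = c *: (x * y) + x * y'.
Proof. exact: (bilinear_combr (mulr_bilinear A)). Qed.

End LinearMaps.

(** * Calculus of Sweedler sums *)

Section TensorLift.

Variables (k : fieldType) (V W : lmodType k).

(** Because [tlift f t] is a finite sum over the chosen representative of [t], this and the next
    three lemmas are facts about finite sums. Linearity in the tensor itself, where the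
    representative changes, is [tlift_combr]. *)
Lemma linear_tlift (U U' : lmodType k) (g : U -> U') (f : V -> W -> U) t :
  linear g -> g (tlift f t) = tlift (fun x y => g (f x y)) t.
Proof. exact: linear_sum_seq. Qed.

Lemma eq_tlift (U : lmodType k) (f g : V -> W -> U) t :
  (forall x y, f x y = g x y) -> tlift f t = tlift g t.
Proof. by move=> fg; apply: eq_bigr => p _. Qed.

Lemma tlift_comb (U : lmodType k) c (f g : V -> W -> U) t :
  tlift (fun x y => c *: f x y + g x y) t = c *: tlift f t + tlift g t.
Proof. by rewrite /tlift scaler_sumr -big_split. Qed.

Lemma exchange_tlift (V' W' U : lmodType k) (F : V -> W -> V' -> W' -> U) s t :
  tlift (fun x y => tlift (F x y) t) s
  = tlift (fun x' y' => tlift (fun x y => F x y x' y') s) t.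
Proof. exact: exchange_big. Qed.

Lemma tlift_combr (U : lmodType k) (f : V -> W -> U) c s t :
  is_bilinear f -> tlift f (c *: s + t) = c *: tlift f s + tlift f t.
Proof. by move=> f_lin; apply: tlift_linear. Qed.

End TensorLift.

Section TensorLiftMaps.

Variables (k : fieldType) (V W : lmodType k).

Lemma tlift_map (V' W' U : lmodType k) (f : V' -> W' -> U) (g : V -> V')
    (h : W -> W') t :
  is_bilinear f -> tlift f (tens_map g h t) = tlift (fun x y => f (g x) (h y)) t.
Proof.
move=> f_lin; rewrite /tens_map (linear_tlift _ _ (tlift_linear f_lin)).
by apply: eq_tlift => x y; rewrite tliftE.
Qed.

Lemma tlift_tens_assoc (X U : lmodType k) (f : X -> V ⊗ W -> U) T :
  is_bilinear f ->
  tlift f (tens_assoc T) = tlift (fun x w => tlift (fun u v => f u (v ⊗ w)) x) T.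
Proof.
move=> f_lin; rewrite /tens_assoc (linear_tlift _ _ (tlift_linear f_lin)).
apply: eq_tlift => x w; rewrite (linear_tlift _ _ (tlift_linear f_lin)).
by apply: eq_tlift => u v; rewrite tliftE.
Qed.

End TensorLiftMaps.

(** The product of [A ⊗ B] is by definition a double [tlift]; the linear map [tlift f] is pushed
    through both of its sums. *)
Lemma tliftM (k : fieldType) (A B : algType k) (U : lmodType k)
    (f : A -> B -> U) (s t : A ⊗ B) :
  is_bilinear f ->
  tlift f (s * t) = tlift (fun x y => tlift (fun x' y' => f (x * x') (y * y')) t) s.
Proof.
move=> f_lin; have -> : s * t =
    tlift (fun x y => tlift (fun x' y' => (x * x') ⊗ (y * y')) t) s.
  by [].
rewrite (linear_tlift _ _ (tlift_linear f_lin)); apply: eq_tlift => x y.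
rewrite (linear_tlift _ _ (tlift_linear f_lin)); apply: eq_tlift => x' y'.
by rewrite tliftE.
Qed.

Lemma tlift_mulr (k : fieldType) (V W V' W' : lmodType k) (A : algType k)
    (f : V -> W -> A) (g : V' -> W' -> A) s t :
  tlift f s * tlift g t
  = tlift (fun x y => tlift (fun x' y' => f x y * g x' y') t) s.
Proof.
by rewrite /tlift mulr_suml; apply: eq_bigr => p _; rewrite mulr_sumr.
Qed.

(** * Algebra morphisms between tensor products *)

Section TensorAlgebraMaps.

Variables (k : fieldType) (A B C : algType k).

Lemma tens_combl (V W : lmodType k) c (v v' : V) (w : W) :
  (c *: v + v') ⊗ w = c *: (v ⊗ w) + v' ⊗ w.
Proof. by rewrite tensDl tensZl. Qed.

Lemma tens_combr (V W : lmodType k) c (v : V) (w w' : W) :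
  v ⊗ (c *: w + w') = c *: (v ⊗ w) + v ⊗ w'.
Proof. by rewrite tensDr tensZr. Qed.

Lemma tens_assoc_bilinear (U V W : lmodType k) :
  is_bilinear (fun (x : U ⊗ V) (w : W) => tlift (fun u v => u ⊗ (v ⊗ w)) x).
Proof.
split=> [w c x x'|x c w w'] /=.
  apply: tlift_combr; split=> [v a u u'|u a v v'] /=.
    exact: tens_combl.
  by rewrite tens_combl tens_combr.
by rewrite -tlift_comb; apply: eq_tlift => u v; rewrite !tens_combr.
Qed.

(** Both sides expand to the same sum over pure tensors. With this, identities between triple
    tensors can be multiplied together inside H ⊗ (H ⊗ H). *)
Lemma tens_assocM : {morph @tens_assoc k A B C : s t / s * t}.
Proof.
move=> s t; rewrite /tens_assoc tliftM; last exact: tens_assoc_bilinear.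
rewrite tlift_mulr; apply: eq_tlift => x w; apply: eq_tlift => x' w'.
rewrite tliftM; last first.
  split=> [v c u u'|u c v v'] /=; first exact: tens_combl.
  by rewrite tens_combl tens_combr.
rewrite tlift_mulr; apply: eq_tlift => u v; apply: eq_tlift => u' v'.
by rewrite !tensM.
Qed.

Lemma tens_assoc1 : tens_assoc (1 : (A ⊗ B) ⊗ C) = 1.
Proof. by rewrite -!tens1 tens_assocE. Qed.

Lemma tens_mapM (A' B' : algType k) (f : A -> A') (g : B -> B') :
  linear f -> linear g -> {morph f : x y / x * y} -> {morph g : x y / x * y} ->
  {morph tens_map f g : s t / s * t}.
Proof.
move=> f_lin g_lin fM gM s t; rewrite /tens_map tliftM; last first.
  split=> [y c x x'|x c y y'] /=; first by rewrite f_lin tens_combl.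
  by rewrite g_lin tens_combr.
rewrite tlift_mulr; apply: eq_tlift => x y; apply: eq_tlift => x' y'.
by rewrite fM gM tensM.
Qed.

Lemma tens_map1 (A' B' : algType k) (f : A -> A') (g : B -> B') :
  linear f -> linear g -> f 1 = 1 -> g 1 = 1 -> tens_map f g 1 = 1.
Proof. by move=> f_lin g_lin f1 g1; rewrite -tens1 tens_mapE // f1 g1. Qed.

End TensorAlgebraMaps.

Lemma tlift1 (k : fieldType) (A B : algType k) (U : lmodType k)
    (f : A -> B -> U) : is_bilinear f -> tlift f 1 = f 1 1.
Proof. by move=> f_lin; rewrite -tens1 tliftE. Qed.

(** * Trilinear maps on triple tensors *)

Definition is_trilinear (k : fieldType) (X Y Z U : lmodType k)
    (f : X -> Y -> Z -> U) :=
  [/\ forall y z, linear (fun x => f x y z), forall x z, linear (fun y => f x y z)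
    & forall x y, linear (f x y)].

Section Trilinear.

Variables (k : fieldType) (X Y Z U : lmodType k) (f : X -> Y -> Z -> U).
Hypothesis f_lin : is_trilinear f.

Let f_lin12 z : is_bilinear (fun x y => f x y z).
Proof. by have [l1 l2 _] := f_lin; split=> [y|x]; [apply: l1|apply: l2]. Qed.

Let f_lin23 x : is_bilinear (f x).
Proof. by have [_ l2 l3] := f_lin; split=> [z|y]; [apply: l2|apply: l3]. Qed.

Lemma tlift_trilinearl :
  is_bilinear (fun x (s : Y ⊗ Z) => tlift (fun y z => f x y z) s).
Proof.
have [l1 l2 l3] := f_lin; split=> [s c x x'|x c s s'] /=.
  by rewrite -tlift_comb; apply: eq_tlift => y z; apply: l1.
exact: tlift_combr.
Qed.

Lemma tlift_trilinearr :
  is_bilinear (fun (s : X ⊗ Y) z => tlift (fun x y => f x y z) s).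
Proof.
have [l1 l2 l3] := f_lin; split=> [z c s s'|s c z z'] /=; first exact: tlift_combr.
by rewrite -tlift_comb; apply: eq_tlift => x y; apply: l3.
Qed.

(** The bridge to Sweedler form: under the lift of a trilinear map, the two bracketings of a triple
    tensor become two nestings of sums. *)
Lemma tlift_assoc (T : (X ⊗ Y) ⊗ Z) :
  tlift (fun x s => tlift (f x) s) (tens_assoc T)
  = tlift (fun s z => tlift (fun x y => f x y z) s) T.
Proof.
rewrite tlift_tens_assoc; last exact: tlift_trilinearl.
by apply: eq_tlift => s z; apply: eq_tlift => x y; rewrite tliftE.
Qed.

End Trilinear.

(** * Sweedler identities in a Hopf algebra *)

Section Twist.

Variables (k : fieldType) (H : algType k) (D : hopf_data H).
Hypothesis hopfD : is_hopf D.

Local Notation eps := (counit D).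
Local Notation S := (antipode D).

Let comul_lin : linear (comul D). Proof. exact: comul_linear hopfD. Qed.
Let eps_lin : scalar eps. Proof. exact: counit_linear hopfD. Qed.
Let S_lin : linear S. Proof. exact: antipode_linear hopfD. Qed.

Lemma tlift_comulA (U : lmodType k) (f : H -> H -> H -> U) h :
  is_trilinear f ->
  tlift (fun x z => tlift (fun x' y => f x' y z) (comul D x)) (comul D h)
  = tlift (fun x y => tlift (f x) (comul D y)) (comul D h).
Proof.
move=> f_lin; have := congr1 (tlift (fun x s => tlift (f x) s)) (comulA hopfD h).
rewrite tlift_assoc // !tlift_map //; first exact: tlift_trilinearl.
exact: tlift_trilinearr.
Qed.

Let comulMl t1 t2 : tens_map (comul D) (@id H) (t1 * t2) =
  tens_map (comul D) id t1 * tens_map (comul D) id t2.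
Proof. by apply: tens_mapM => //; apply: comulM. Qed.

Let comulMr t1 t2 : tens_map (@id H) (comul D) (t1 * t2) =
  tens_map id (comul D) t1 * tens_map id (comul D) t2.
Proof. by apply: tens_mapM => //; apply: comulM. Qed.

(** The middle factor [w], here and in the next lemma, leaves room for the elements u and v that
    occur in the twisted antipode axioms. *)
Lemma antipode_bilinear (w : H) : is_bilinear (fun x y => S x * w * y).
Proof.
by split=> [y c x x'|x c y y'] /=; rewrite ?S_lin ?mulr_combl ?mulr_combr.
Qed.

Lemma bilinear_antipode (w : H) : is_bilinear (fun x y => x * w * S y).
Proof.
by split=> [y c x x'|x c y y'] /=; rewrite ?S_lin ?mulr_combl ?mulr_combr.
Qed.

Lemma antipode1 : S 1 = 1.
Proof.
have := antipodel hopfD 1; rewrite (comul1 hopfD) (counit1 hopfD) scale1r.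
rewrite tlift1 ?mulr1 //.
by split=> [y c x x'|x c y y'] /=; rewrite ?S_lin ?mulr_combl ?mulr_combr.
Qed.

Lemma tlift_counitl (U : lmodType k) (f : H -> U) h :
  linear f -> tlift (fun x y => eps x *: f y) (comul D h) = f h.
Proof.
move=> f_lin; rewrite -{2}[h](counitl hopfD) linear_tlift //.
by apply: eq_tlift => x y; rewrite linear_scale.
Qed.

Lemma tlift_counitr (U : lmodType k) (f : H -> U) h :
  linear f -> tlift (fun x y => eps y *: f x) (comul D h) = f h.
Proof.
move=> f_lin; rewrite -{2}[h](counitr hopfD) linear_tlift //.
by apply: eq_tlift => x y; rewrite linear_scale.
Qed.

Lemma antipode_mul_bilinear : is_bilinear (fun x y => S x * y).
Proof.
by split=> [y c x x'|x c y y'] /=; rewrite ?S_lin ?mulr_combl ?mulr_combr.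
Qed.

(* Both sides equal the sum of S(g1 h1) g2 h2 S(h3) S(g3). *)
Lemma antipodeM g h : S (g * h) = S h * S g.
Proof.
pose X := tlift (fun x y => tlift (fun p q =>
  tlift (fun u v => tlift (fun r s => S (u * r) * (v * s) * (S q * S y))
    (comul D p)) (comul D x)) (comul D h)) (comul D g).
transitivity X.
  pose F u v y := tlift (fun p q =>
    tlift (fun r s => S (u * r) * (v * s) * (S q * S y)) (comul D p)) (comul D h).
  have F_lin : is_trilinear F.
    split=> [v y c u u'|u y c v v'|u v c y y']; rewrite -tlift_comb;
    apply: eq_tlift => p q; rewrite -tlift_comb; apply: eq_tlift => r s;
    by rewrite ?(S_lin, mulr_combl, mulr_combr).
  have -> : X = tlift (fun x y => tlift (fun u v => F u v y) (comul D x)) (comul D g).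
    by apply: eq_tlift => x y; rewrite /F exchange_tlift.
  rewrite tlift_comulA //.
  have GE x v y : F x v y = tlift (fun r b =>
      tlift (fun s q => S (x * r) * (v * s) * (S q * S y)) (comul D b)) (comul D h).
    pose f r s q := S (x * r) * (v * s) * (S q * S y).
    rewrite /F -[RHS](@tlift_comulA _ f) //.
    split=> [a b c u u'|a b c u u'|a b c u u']; rewrite /f;
      by rewrite ?(S_lin, mulr_combl, mulr_combr).
  (* The sum is built up from S(g h): ε of the last leg of g is expanded to g^(2) S(g^(3)), and
     inside it ε of the last leg of h to h^(2) S(h^(3)). *)
  transitivity (tlift (fun x b => eps b *: S (x * h)) (comul D g)).
    by rewrite tlift_counitr // => c x x'; rewrite mulr_combl S_lin.
  apply: eq_tlift => x b.
  transitivity (tlift (fun v y => S (x * h) * (v * S y)) (comul D b)).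
    rewrite -(linear_tlift _ _ (g := fun z => S (x * h) * z)); last first.
      by move=> c z z'; rewrite mulr_combr.
    by rewrite (antipoder hopfD) -scalerAr mulr1.
  apply: eq_tlift => v y; rewrite GE.
  transitivity (tlift (fun r b0 => eps b0 *: (S (x * r) * (v * S y))) (comul D h)).
    by rewrite tlift_counitr // => c z z'; rewrite mulr_combr S_lin mulr_combl.
  apply: eq_tlift => r d.
  transitivity (tlift (fun s q => S (x * r) * v * (s * S q) * S y) (comul D d)).
    rewrite -(linear_tlift _ _ (g := fun z => S (x * r) * v * z * S y)); last first.
      by move=> c z z'; rewrite mulr_combr mulr_combl.
    by rewrite (antipoder hopfD) -scalerAr mulr1 -scalerAl mulrA.
  by apply: eq_tlift => s q; rewrite !mulrA.
have multl c0 : linear (fun z => z * c0 : H).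
  by move=> c z z'; rewrite mulr_combl.
(* Second half: in [X], the antipode axiom for the product [x * p] collapses the first four factors
   to ε(x) ε(p), and the counit axioms remove both scalars. *)
transitivity (tlift (fun x y => eps x *: (S h * S y)) (comul D g)); last first.
  by rewrite tlift_counitl // => c z z'; rewrite S_lin mulr_combr.
apply: eq_tlift => x y.
transitivity (tlift (fun p q => eps p *: (eps x *: (S q * S y))) (comul D h));
  last first.
  rewrite (@tlift_counitl _ (fun z => eps x *: (S z * S y))) // => c z z'.
  rewrite S_lin mulr_combl scalerDr !scalerA; congr (_ *: _ + _).
  exact: mulrC.
apply: eq_tlift => p q.
rewrite scalerA mulrC -(counitM hopfD) -[S q * S y]mul1r scalerAl.
rewrite -(antipodel hopfD) (comulM hopfD) tliftM; last exact: antipode_mul_bilinear.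
rewrite (linear_tlift _ _ (multl _)); apply: eq_tlift => u v.
by rewrite (linear_tlift _ _ (multl _)); apply: eq_tlift => r s; rewrite mul1r.
Qed.

(** Since S reverses products, S(x' x) w y' y nests as S(x) (S(x') w y') y, so a product of tensors
    is evaluated one factor at a time. The left factor [s] is innermost here; in the mirror lemma
    below it is [t]. *)
Lemma tlift_antipodeM (w : H) s t :
  tlift (fun x y => S x * w * y) (s * t)
  = tlift (fun x y => S x * tlift (fun x' y' => S x' * w * y') s * y) t.
Proof.
rewrite tliftM; last exact: antipode_bilinear.
rewrite exchange_tlift; apply: eq_tlift => x y.
rewrite (linear_tlift _ _ (g := fun z => S x * z * y)); last first.
  by move=> c z z'; rewrite mulr_combr mulr_combl.
by apply: eq_tlift => x' y'; rewrite antipodeM !mulrA.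
Qed.

Lemma tlift_Mantipode (w : H) s t :
  tlift (fun x y => x * w * S y) (s * t)
  = tlift (fun x y => x * tlift (fun x' y' => x' * w * S y') t * S y) s.
Proof.
rewrite tliftM; last exact: bilinear_antipode.
apply: eq_tlift => x y.
rewrite (linear_tlift _ _ (g := fun z => x * z * S y)); last first.
  by move=> c z z'; rewrite mulr_combr mulr_combl.
by apply: eq_tlift => x' y'; rewrite antipodeM !mulrA.
Qed.

(** * The twisted Hopf algebra *)

Section TwistHopf.

Variables (Phi PhiV : H ⊗ H).
Hypothesis twistPhi : is_twist D Phi PhiV.

(** The lift of [f] is applied to the cocycle identity. [Phi ⊗ 1] and [1 ⊗ Phi] are pure tensors for
    the outer product, so one leg is multiplied by 1 and the coproduct of the other by [Phi]. *)
Lemma tlift_cocycle (U : lmodType k) (f : H -> H -> H -> U) :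
  is_trilinear f ->
  tlift (fun x z => tlift (fun x' y => f x' y z) (comul D x * Phi)) Phi
  = tlift (fun x y => tlift (f x) (comul D y * Phi)) Phi.
Proof.
move=> f_lin.
have := congr1 (tlift (fun x s => tlift (f x) s)) (twist_cocycle twistPhi).
have linr := tlift_trilinearr f_lin; have linl := tlift_trilinearl f_lin.
rewrite tlift_assoc // !tliftM //.
have l1 (x : H ⊗ H) (y : H) : is_bilinear (fun s z =>
    tlift (fun x' y0 => f x' y0 (y * z)) (x * s)).
  split=> [z c s s'|s c z z'] /=; first by rewrite mulr_combr linr.1.
  by rewrite mulr_combr linr.2.
have l2 (x : H) (y : H ⊗ H) : is_bilinear (fun z s => tlift (f (x * z)) (y * s)).
  split=> [s c z z'|z c s s'] /=; first by rewrite mulr_combr linl.1.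
  by rewrite mulr_combr linl.2.
under eq_tlift do rewrite tliftE // mulr1.
under [X in _ = X -> _]eq_tlift do rewrite tliftE // mulr1.
rewrite !tlift_map //.
- split=> [s c z z'|z c s s'] /=; first exact: linl.1.
  by rewrite mulr_combl linl.2.
- split=> [z c s s'|s c z z'] /=; last exact: linr.2.
  by rewrite mulr_combl linr.1.
Qed.

Local Notation D' := (twist_hopf D Phi PhiV).

Let PhiK t : t * Phi * PhiV = t.
Proof. by rewrite -mulrA (twist_mulV twistPhi) mulr1. Qed.

(** In H ⊗ (H ⊗ H) the two sides are [PhiV12 * L t * Phi12] and [PhiV23 * R t * Phi23] with t = Φ^-1
    Δ(h) Φ. They agree by the cocycle identity on the right, its inverse on the left and
    coassociativity in the middle. *)
Lemma twist_comulA h :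
  tens_assoc (tens_map (comul D') id (comul D' h))
  = tens_map id (comul D') (comul D' h).
Proof.
pose L t := tens_assoc (tens_map (comul D) (@id H) t).
pose R t := tens_map (@id H) (comul D) t.
have LM : {morph L : s t / s * t} by move=> s t; rewrite /L comulMl tens_assocM.
have RM : {morph R : s t / s * t} by move=> s t; apply: comulMr.
have L1 : L 1 = 1 by rewrite /L tens_map1 ?tens_assoc1 // (comul1 hopfD).
have R1 : R 1 = 1 by rewrite /R tens_map1 // (comul1 hopfD).
pose Phi12 := tens_assoc (Phi ⊗ (1 : H)); pose Phi23 := (1 : H) ⊗ Phi.
pose PhiV12 := tens_assoc (PhiV ⊗ (1 : H)); pose PhiV23 := (1 : H) ⊗ PhiV.
have L'E t : tens_assoc (tens_map (comul D') id t) = PhiV12 * L t * Phi12.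
  rewrite -!tens_assocM; congr tens_assoc.
  rewrite /tens_map.
  rewrite [RHS](linear_tlift _ _ (g := fun z => (PhiV ⊗ 1) * z * (Phi ⊗ 1))).
    by apply: eq_tlift => x y; rewrite !tensM mul1r mulr1.
  by move=> c z z'; rewrite mulr_combr mulr_combl.
have R'E t : tens_map id (comul D') t = PhiV23 * R t * Phi23.
  rewrite /R /tens_map [RHS](linear_tlift _ _ (g := fun z => PhiV23 * z * Phi23)).
    by apply: eq_tlift => x y; rewrite !tensM mul1r mulr1.
  by move=> c z z'; rewrite mulr_combr mulr_combl.
have cocycle : L Phi * Phi12 = R Phi * Phi23.
  by rewrite -(twist_cocycle twistPhi) tens_assocM.
(* A left inverse and a right inverse of the element in [cocycle] coincide. *)
have cocycleV : PhiV12 * L PhiV = PhiV23 * R PhiV.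
  have LV : (PhiV12 * L PhiV) * (L Phi * Phi12) = 1.
    rewrite mulrA -[_ * L Phi]mulrA -LM (twist_mulVr twistPhi) L1 mulr1.
    by rewrite -tens_assocM tensM (twist_mulVr twistPhi) mulr1 tens1 tens_assoc1.
  have RV : (R Phi * Phi23) * (PhiV23 * R PhiV) = 1.
    rewrite mulrA -[_ * PhiV23]mulrA tensM (twist_mulV twistPhi) mulr1 tens1 mulr1.
    by rewrite -RM (twist_mulV twistPhi) R1.
  by rewrite -[LHS]mulr1 -RV mulrA -cocycle LV mul1r.
rewrite L'E R'E /= !LM !RM !mulrA cocycleV -!mulrA cocycle.
by rewrite [L (comul D h)](comulA hopfD).
Qed.

Let counitl_bilinear : is_bilinear (fun x y : H => eps x *: y).
Proof.
split=> [y c x x'|x c y y'] /=; first by rewrite eps_lin scalerDl -scalerA.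
by rewrite scalerDr !scalerA mulrC.
Qed.

Let counitr_bilinear : is_bilinear (fun x y : H => eps y *: x).
Proof.
split=> [y c x x'|x c y y'] /=; last by rewrite eps_lin scalerDl -scalerA.
by rewrite scalerDr !scalerA mulrC.
Qed.

Lemma tlift_counitlM (s t : H ⊗ H) :
  tlift (fun x y => eps x *: y) (s * t)
  = tlift (fun x y => eps x *: y) s * tlift (fun x y => eps x *: y) t.
Proof.
rewrite tliftM // tlift_mulr; apply: eq_tlift => x y; apply: eq_tlift => x' y'.
by rewrite (counitM hopfD) -scalerAl -scalerAr scalerA.
Qed.

Lemma tlift_counitrM (s t : H ⊗ H) :
  tlift (fun x y => eps y *: x) (s * t)
  = tlift (fun x y => eps y *: x) s * tlift (fun x y => eps y *: x) t.
Proof.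
rewrite tliftM // tlift_mulr; apply: eq_tlift => x y; apply: eq_tlift => x' y'.
by rewrite (counitM hopfD) -scalerAl -scalerAr scalerA.
Qed.

(** The map ε ⊗ id is multiplicative and sends [Phi] to 1, hence also its inverse [PhiV]. *)
Lemma twist_counitl_comul h : tlift (fun x y => eps x *: y) (comul D' h) = h.
Proof.
rewrite /= !tlift_counitlM (counitl hopfD) (twist_counitl twistPhi) mulr1.
rewrite -[X in X * h]mulr1 -[X in _ * X * h](twist_counitl twistPhi) -tlift_counitlM.
by rewrite (twist_mulVr twistPhi) tlift1 // (counit1 hopfD) scale1r mul1r.
Qed.

Lemma twist_counitr_comul h : tlift (fun x y => eps y *: x) (comul D' h) = h.
Proof.
rewrite /= !tlift_counitrM (counitr hopfD) (twist_counitr twistPhi) mulr1.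
rewrite -[X in X * h]mulr1 -[X in _ * X * h](twist_counitr twistPhi) -tlift_counitrM.
by rewrite (twist_mulVr twistPhi) tlift1 // (counit1 hopfD) scale1r mul1r.
Qed.

Local Notation u := (tlift (fun x y => x * S y) PhiV).
Local Notation v := (tlift (fun x y => S x * y) Phi).

(** By [tlift_antipodeM] this is the sum of S(x) y over [Phi * PhiV], which is 1. The next lemma
    does the same with x S(y). *)
Lemma tlift_twist_antipode : tlift (fun x y => S x * v * y) PhiV = 1.
Proof.
have -> : v = tlift (fun x y => S x * 1 * y) Phi.
  by apply: eq_tlift => x y; rewrite mulr1.
rewrite -tlift_antipodeM (twist_mulV twistPhi) tlift1 ?antipode1 ?mulr1 //.
exact: antipode_bilinear.
Qed.

Lemma tlift_antipode_twist : tlift (fun x y => x * u * S y) Phi = 1.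
Proof.
have -> : u = tlift (fun x y => x * 1 * S y) PhiV.
  by apply: eq_tlift => x y; rewrite mulr1.
rewrite -tlift_Mantipode (twist_mulV twistPhi) tlift1 ?antipode1 ?mulr1 //.
exact: bilinear_antipode.
Qed.

(* Apply x (x) y (x) z |-> x u S(y) z to the cocycle identity: the left-hand side
   collapses to 1 and the right-hand side to u v. *)
Lemma twist_antipode_mulV : u * v = 1.
Proof.
pose f x y z := x * u * S y * z.
have f_lin : is_trilinear f.
  split=> [y z c x x'|x z c y y'|x y c z z']; rewrite /f;
  by rewrite ?(S_lin, mulr_combl, mulr_combr).
have := tlift_cocycle f_lin; rewrite /f.
have -> : tlift (fun x z => tlift (fun x' y => x' * u * S y * z)
    (comul D x * Phi)) Phi = 1.
  (* With 1 written as (ε ⊗ id)(Φ), it remains that x' u S(y) summed over Δ(x) Φ is ε(x). *)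
  rewrite -[RHS](twist_counitl twistPhi); apply: eq_tlift => x z.
  rewrite -(linear_tlift _ _ (g := fun w => w * z)); last first.
    by move=> c w w'; rewrite mulr_combl.
  rewrite tlift_Mantipode tlift_antipode_twist.
  under eq_tlift do rewrite mulr1.
  by rewrite (antipoder hopfD) -scalerAl mul1r.
(* Now (id ⊗ ε)(Φ) is inserted before u v; it remains that S(p) q summed over Δ(y) Φ is ε(y) v. *)
move=> ->; rewrite -[X in X * v]mul1r -{1}(twist_counitr twistPhi) -mulrA.
rewrite (linear_tlift _ _ (g := fun w => w * (u * v))); last first.
  by move=> c w w'; rewrite mulr_combl.
apply: eq_tlift => x y.
transitivity (x * u * tlift (fun x y => S x * 1 * y) (comul D y * Phi)).
  rewrite tlift_antipodeM.
  have -> : tlift (fun x y => S x * 1 * y) (comul D y) = (eps y)%:A.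
    by rewrite -(antipodel hopfD); apply: eq_tlift => ? ?; rewrite mulr1.
  rewrite !mulrA -!scalerAl scalerAr; congr (_ * _); rewrite linear_tlift; last first.
    by move=> c z z'; rewrite scalerDr !scalerA mulrC.
  by apply: eq_tlift => p q; rewrite -scalerAr mulr1 -scalerAl.
rewrite (linear_tlift _ _ (g := fun w => x * u * w)); last first.
  by move=> c w w'; rewrite mulr_combr.
by apply: eq_tlift => p q; rewrite mulr1 !mulrA.
Qed.

(** With u pulled to the front, S(x) v y over Φ^-1 Δ(h) Φ is evaluated from the inside: Φ^-1 gives
    1, Δ(h) gives ε(h), and Φ gives v. The result ε(h) u v is ε(h) because u v = 1. *)
Lemma twist_antipodel h :
  tlift (fun x y => antipode D' x * y) (comul D' h) = (counit D' h)%:A.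
Proof.
rewrite /=; transitivity (u * tlift (fun x y => S x * v * y) (PhiV * comul D h * Phi)).
  rewrite (linear_tlift _ _ (g := fun w => u * w)).
    by apply: eq_tlift => x y; rewrite !mulrA.
  by move=> c w w'; rewrite mulr_combr.
rewrite !tlift_antipodeM tlift_twist_antipode -[X in _ = _ *: X]twist_antipode_mulV.
have -> : tlift (fun x y => S x * 1 * y) (comul D h) = (eps h)%:A.
  by rewrite -(antipodel hopfD); apply: eq_tlift => ? ?; rewrite mulr1.
rewrite scalerAr; congr (_ * _); rewrite linear_tlift; last first.
  by move=> c z z'; rewrite scalerDr !scalerA mulrC.
by apply: eq_tlift => p q; rewrite -scalerAr mulr1 -scalerAl.
Qed.

Lemma twist_antipoder h :
  tlift (fun x y => x * antipode D' y) (comul D' h) = (counit D' h)%:A.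
Proof.
rewrite /=; transitivity (tlift (fun x y => x * u * S y) (PhiV * comul D h * Phi) * v).
  rewrite (linear_tlift _ _ (g := fun w => w * v)).
    by apply: eq_tlift => x y; rewrite !mulrA.
  by move=> c w w'; rewrite mulr_combl.
rewrite -mulrA tlift_Mantipode.
under [X in X * v]eq_tlift do rewrite tlift_Mantipode tlift_antipode_twist.
have -> : tlift (fun x y => x * 1 * S y) (comul D h) = (eps h)%:A.
  by rewrite -(antipoder hopfD); apply: eq_tlift => ? ?; rewrite mulr1.
rewrite -[X in _ = _ *: X]twist_antipode_mulV scalerAl; congr (_ * _).
rewrite linear_tlift; last first.
  by move=> c z z'; rewrite scalerDr !scalerA mulrC.
by apply: eq_tlift => p q; rewrite -scalerAr mulr1 -scalerAl.
Qed.

Lemma twist_is_hopf : is_hopf D'.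
Proof.
split.
- by move=> c h h' /=; rewrite comul_lin mulr_combr mulr_combl.
- by rewrite /= (comul1 hopfD) mulr1 (twist_mulVr twistPhi).
- by move=> g h /=; rewrite (comulM hopfD) !mulrA PhiK.
- exact: twist_comulA.
- exact: eps_lin.
- exact: (counit1 hopfD).
- exact: (counitM hopfD).
- exact: twist_counitl_comul.
- exact: twist_counitr_comul.
- by move=> c h h' /=; rewrite S_lin mulr_combr mulr_combl.
- exact: twist_antipodel.
- exact: twist_antipoder.
Qed.

End TwistHopf.

End Twist.

(** * Covariance of modules and of the twisted action *)

Section Modules.

Variables (k : fieldType) (H : algType k) (A W : lmodType k).
Variables (alpha : H -> A -> A) (rho : H -> W -> W) (pi : A -> W -> W).
Hypotheses (alpha_mod : is_hmodule alpha) (rho_mod : is_hmodule rho).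
Hypothesis pi_lin : is_bilinear pi.

Let alpha_lin := hmodule_bilinear alpha_mod.
Let rho_lin := hmodule_bilinear rho_mod.

Let combs := (bilinear_combl alpha_lin, bilinear_combr alpha_lin,
  bilinear_combl rho_lin, bilinear_combr rho_lin,
  bilinear_combl pi_lin, bilinear_combr pi_lin, mulr_combl, mulr_combr).

Lemma act2_bilinear a w : is_bilinear (fun x y => pi (alpha x a) (rho y w)).
Proof. by split=> [y c x x'|x c y y'] /=; rewrite !combs. Qed.

Lemma twist_act_bilinear Phi : is_bilinear (twist_act Phi alpha pi rho).
Proof.
split=> [w c a a'|a c w w']; rewrite /twist_act -tlift_comb;
  by apply: eq_tlift => x y; rewrite !combs.
Qed.

(** For W = A, [rho := alpha] and [pi := mu] this is the module algebra axiom, so the lemmas of this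
    section serve both the twisted algebra and the twisted module. *)
Definition leibniz (D : hopf_data H) := forall h a w,
  rho h (pi a w) = tlift (fun x y => pi (alpha x a) (rho y w)) (comul D h).

Definition antipode_covariant (D : hopf_data H) := forall h a w,
  pi (alpha h a) w
  = tlift (fun x y => rho x (pi a (rho (antipode D y) w))) (comul D h).

Section Covariance.

Variable D : hopf_data H.
Hypothesis hopfD : is_hopf D.

Let S_lin : linear (antipode D). Proof. exact: antipode_linear hopfD. Qed.

(** Moving h^(1) a out by the antipode form gives h^(1) (a . (S(h^(2)) h^(3) w)), and
    coassociativity lets the last two legs collapse to ε. *)
Lemma leibniz_of_covariant : antipode_covariant D -> leibniz D.
Proof.
move=> cov h a w; pose f x z y := rho x (pi a (rho (antipode D z) (rho y w))).
transitivity (tlift (fun x y => tlift (f x) (comul D y)) (comul D h)); last first.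
  rewrite -(@tlift_comulA _ _ _ hopfD _ f).
    by apply: eq_tlift => x y; rewrite cov.
  by split=> [y z c x x'|x z c y y'|x y c z z']; rewrite /f ?S_lin !combs.
transitivity (tlift (fun x y => counit D y *: rho x (pi a w)) (comul D h)).
  rewrite (tlift_counitr hopfD (f := fun x => rho x (pi a w))) // => c x x'.
  by rewrite combs.
apply: eq_tlift => x y; rewrite /f.
rewrite -(linear_tlift _ _ (g := fun z => rho x (pi a z))); last first.
  by move=> c z z'; rewrite !combs.
transitivity (rho x (pi a (rho (counit D y)%:A w))).
  rewrite (bilinear_scalel rho_lin) (hmodule1 rho_mod).
  by rewrite (bilinear_scaler pi_lin) (bilinear_scaler rho_lin).
rewrite -(antipodel hopfD) (linear_tlift _ _ (g := fun z => rho z w)); last first.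
  by move=> c z z'; rewrite combs.
by congr (rho _ (pi _ _)); apply: eq_tlift => z z'; rewrite (hmoduleM rho_mod).
Qed.

(** Expanding h^(1) (a . (S(h^(2)) w)) gives (h^(1) a) . (h^(2) S(h^(3)) w), where the last two legs
    collapse to ε. *)
Lemma covariant_of_leibniz : leibniz D -> antipode_covariant D.
Proof.
move=> leib h a w.
pose f x y z := pi (alpha x a) (rho y (rho (antipode D z) w)).
transitivity (tlift (fun x z => tlift (fun x' y => f x' y z) (comul D x))
  (comul D h)); last first.
  by apply: eq_tlift => x y; rewrite leib.
rewrite (@tlift_comulA _ _ _ hopfD); last first.
  by split=> [y z c x x'|x z c y y'|x y c z z']; rewrite /f ?S_lin !combs.
transitivity (tlift (fun x y => counit D y *: pi (alpha x a) w) (comul D h)).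
  rewrite (tlift_counitr hopfD (f := fun x => pi (alpha x a) w)) // => c x x'.
  by rewrite !combs.
apply: eq_tlift => x y; rewrite /f.
rewrite -(linear_tlift _ _ (g := fun z => pi (alpha x a) z)); last first.
  by move=> c z z'; rewrite !combs.
transitivity (pi (alpha x a) (rho (counit D y)%:A w)).
  by rewrite (bilinear_scalel rho_lin) (hmodule1 rho_mod) (bilinear_scaler pi_lin).
rewrite -(antipoder hopfD) (linear_tlift _ _ (g := fun z => rho z w)); last first.
  by move=> c z z'; rewrite combs.
by congr (pi _ _); apply: eq_tlift => z z'; rewrite (hmoduleM rho_mod).
Qed.

End Covariance.

Lemma tlift_actM (s t : H ⊗ H) a w :
  tlift (fun x y => pi (alpha x a) (rho y w)) (s * t)
  = tlift (fun x y => tlift (fun x' y' =>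
      pi (alpha x' (alpha x a)) (rho y' (rho y w))) s) t.
Proof.
rewrite tliftM; last exact: act2_bilinear.
rewrite exchange_tlift; apply: eq_tlift => x y; apply: eq_tlift => x' y'.
by rewrite (hmoduleM alpha_mod) (hmoduleM rho_mod).
Qed.

(** Both associativity and covariance of * rest on this form, in which h and the twist enter only
    through Δ(h) Φ. *)
Lemma act_twist_act D (Phi : H ⊗ H) h a w :
  leibniz D ->
  rho h (twist_act Phi alpha pi rho a w)
  = tlift (fun x y => pi (alpha x a) (rho y w)) (comul D h * Phi).
Proof.
move=> leib; rewrite tlift_actM /twist_act linear_tlift; last exact: rho_lin.2.
by apply: eq_tlift => x y; rewrite leib.
Qed.

Lemma twist_leibniz D (Phi PhiV : H ⊗ H) h a w :
  leibniz D -> is_twist D Phi PhiV ->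
  rho h (twist_act Phi alpha pi rho a w)
  = tlift (fun x y => twist_act Phi alpha pi rho (alpha x a) (rho y w))
      (comul (twist_hopf D Phi PhiV) h).
Proof.
move=> leib twistPhi; rewrite -tlift_actM (act_twist_act _ _ _ _ leib) /=.
by rewrite !mulrA (twist_mulV twistPhi) mul1r.
Qed.

(** For invariant [e], Φ_1 e . Φ_2 w equals e . (ε(Φ_1) Φ_2 w), and (ε ⊗ id)(Φ) = 1. Applied to a
    unit, this shows that twisting preserves it. *)
Lemma twist_act_invariantl D (Phi PhiV : H ⊗ H) e w :
  is_twist D Phi PhiV -> (forall h, alpha h e = counit D h *: e) ->
  twist_act Phi alpha pi rho e w = pi e w.
Proof.
move=> twistPhi he; rewrite -[w in RHS](hmodule1 rho_mod) -(twist_counitl twistPhi).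
rewrite (linear_tlift _ _ (g := fun z => pi e (rho z w))).
  apply: eq_tlift => x y.
  rewrite he (bilinear_scalel pi_lin) (bilinear_scalel rho_lin).
  by rewrite (bilinear_scaler pi_lin).
by move=> c z z'; rewrite !combs.
Qed.

Lemma twist_act_invariantr D (Phi PhiV : H ⊗ H) a e :
  is_twist D Phi PhiV -> (forall h, rho h e = counit D h *: e) ->
  twist_act Phi alpha pi rho a e = pi a e.
Proof.
move=> twistPhi he; rewrite -[a in RHS](hmodule1 alpha_mod) -(twist_counitr twistPhi).
rewrite (linear_tlift _ _ (g := fun z => pi (alpha z a) e)).
  apply: eq_tlift => x y.
  rewrite he (bilinear_scaler pi_lin) (bilinear_scalel alpha_lin).
  by rewrite (bilinear_scalel pi_lin).
by move=> c z z'; rewrite !combs.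
Qed.

End Modules.

(** * Associativity of the twisted action, units, and the theorem *)

Lemma twist_actA (k : fieldType) (H : algType k) (D : hopf_data H)
    (Phi PhiV : H ⊗ H) (A W : lmodType k) (mu : A -> A -> A)
    (alpha : H -> A -> A) (rho : H -> W -> W) (pi : A -> W -> W) a b w :
  is_twist D Phi PhiV -> is_module_algebra D mu alpha ->
  is_hmodule rho -> is_algebra_action mu pi -> leibniz alpha rho pi D ->
  twist_act Phi alpha pi rho (twist_mul Phi mu alpha a b) w
  = twist_act Phi alpha pi rho a (twist_act Phi alpha pi rho b w).
Proof.
move=> twistPhi modalgA rho_mod [pi_lin piM] leib.
have alpha_mod := modalg_hmodule modalgA.
have [alpha_lin rho_lin] := (hmodule_bilinear alpha_mod, hmodule_bilinear rho_mod).
pose combs := (bilinear_combl alpha_lin, bilinear_combl rho_lin,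
  bilinear_combl pi_lin, bilinear_combr pi_lin).
pose f x y z := pi (alpha x a) (pi (alpha y b) (rho z w)).
transitivity (tlift (fun x z => tlift (fun x' y => f x' y z) (comul D x * Phi)) Phi).
  apply: eq_tlift => x z.
  (* [twist_mul] is [twist_act] at [pi := mu], with the module algebra axiom as its Leibniz rule. *)
  rewrite [alpha x _](act_twist_act alpha_mod alpha_mod (modalg_bilinear modalgA)
    _ _ _ _ (modalg_comul modalgA)).
  rewrite (linear_tlift _ _ (g := fun c => pi c (rho z w))).
    by apply: eq_tlift => x' y; rewrite piM.
  by move=> c t t'; rewrite combs.
rewrite (tlift_cocycle twistPhi); last first.
  by split=> [y z c x x'|x z c y y'|x y c z z']; rewrite /f !combs.
apply: eq_tlift => x y; rewrite (act_twist_act alpha_mod rho_mod pi_lin _ _ _ _ leib).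
by rewrite linear_tlift //; apply: pi_lin.2.
Qed.

(* For h a = ε(h) a no compatibility of the action with the unit is assumed:
   it follows from (h e) b = h^(1) (e (S(h^(2)) b)) = ε(h) b at b = e. *)
Lemma modalg_unit_invariant (k : fieldType) (H : algType k) (D : hopf_data H)
    (A : lmodType k) (mu : A -> A -> A) (alpha : H -> A -> A) (e : A) h :
  is_hopf D -> is_module_algebra D mu alpha -> left_id e mu -> right_id e mu ->
  alpha h e = counit D h *: e.
Proof.
move=> hopfD modalgA mu1l mu1r; have alpha_mod := modalg_hmodule modalgA.
have cov := covariant_of_leibniz alpha_mod alpha_mod (modalg_bilinear modalgA)
  hopfD (modalg_comul modalgA).
rewrite -[LHS]mu1r cov -{3}(hmodule1 alpha_mod e).
rewrite -(bilinear_scalel (hmodule_bilinear alpha_mod)) -(antipoder hopfD).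
rewrite (linear_tlift _ _ (g := fun z => alpha z e)); last first.
  exact: (hmodule_bilinear alpha_mod).1.
by apply: eq_tlift => x y; rewrite mu1l (hmoduleM alpha_mod).
Qed.

(** The clause on [D'] certifies the explicit antipode that the covariance clause uses. As module
    algebras are defined here without a unit, the unital case is the last clause. *)
Theorem mainTheorem3 (k : fieldType) (H : algType k) (D : hopf_data H)
    (Phi PhiV : H ⊗ H) (A W : lmodType k)
    (mu : A -> A -> A) (alpha : H -> A -> A)
    (pi : A -> W -> W) (rho : H -> W -> W)
    (hopfD : is_hopf D) (twistPhi : is_twist D Phi PhiV)
    (modalgA : is_module_algebra D mu alpha)
    (covmodW : is_covariant_module D mu alpha pi rho) :
  let D' := twist_hopf D Phi PhiV in
  let mu' := twist_mul Phi mu alpha in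
  let pi' := twist_act Phi alpha pi rho in
  [/\ is_hopf D',
      is_module_algebra D' mu' alpha,
      is_algebra_action mu' pi',
      is_covariant_module D' mu' alpha pi' rho
    & forall e : A,
        left_id e mu -> right_id e mu -> (forall w, pi e w = w) ->
        [/\ left_id e mu', right_id e mu' & forall w, pi' e w = w]].
Proof.
move=> D' mu' pi'; have alpha_mod := modalg_hmodule modalgA.
have rho_mod := covmod_hmodule covmodW; have pi_act := covmod_action covmodW.
have pi_lin := algact_bilinear pi_act; have mu_lin := modalg_bilinear modalgA.
have mu_leib := modalg_comul modalgA.
have pi_leib := leibniz_of_covariant rho_mod pi_lin hopfD
  (covmod_covariant covmodW).
have hopfD' : is_hopf D' := twist_is_hopf hopfD twistPhi.
have pi'_lin : is_bilinear pi' := twist_act_bilinear alpha_mod rho_mod pi_lin Phi.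
have pi'_act : is_algebra_action mu' pi'.
  split=> // a b w; exact: (twist_actA _ _ _ twistPhi modalgA).
split=> //.
(* The twisted algebra is treated as A acting on itself by [mu]. *)
- split=> //.
  + exact: (twist_act_bilinear alpha_mod alpha_mod mu_lin Phi).
  + move=> a b c; symmetry.
    apply: (twist_actA (pi := mu) _ _ _ twistPhi) => //.
    by split=> // ? ? ?; rewrite (Defs.modalgA modalgA).
  + by move=> h a b; apply: (twist_leibniz alpha_mod alpha_mod mu_lin).
- split=> //; apply: (covariant_of_leibniz alpha_mod rho_mod) => //.
  by move=> h a w; apply: (twist_leibniz alpha_mod rho_mod pi_lin).
- move=> e mu1l mu1r pi1.
  (* Invariance of [e] makes * agree with the untwisted operations whenever one argument is [e]. *)
  have he h := modalg_unit_invariant h hopfD modalgA mu1l mu1r.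
  split=> [a|a|w].
  + by rewrite -[RHS]mu1l; apply: (twist_act_invariantl alpha_mod mu_lin _ twistPhi).
  + by rewrite -[RHS]mu1r; apply: (twist_act_invariantr alpha_mod mu_lin _ twistPhi).
  + by rewrite -[RHS]pi1; apply: (twist_act_invariantl rho_mod pi_lin _ twistPhi).
Qed.
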